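(* Almost every $n$-vertex graph is such that the multiset of its induced subgraphs with $3\log_2 n$ vertices is sufficient to determine it up to isomorphism. In other words, for almost every $n$-vertex graph $G$, the collection $\{(F, C_G(F))\}_{F\in\Gamma_{3\log_2 n}}$ determines $G$ up to isomorphism: if $G'$ is any $n$-vertex graph with $C_{G'}(F)=C_G(F)$ for every $F\in\Gamma_{3\log_2 n}$, then $G'\cong G$.
   Context: Graphs are finite, simple, undirected; all subgraphs are induced subgraphs. $\Gamma_m$ denotes the set of all (isomorphism types of) graphs on $m$ vertices. For graphs $F$ and $G$, the multiplicity $C_G(F)$ is the number of induced subgraphs of $G$ isomorphic to $F$. ''Almost every $n$-vertex graph has property $Q$'' means: in the random graph on $n$ labeled vertices where each edge is present independently with probability $1/2$, the probability that $G$ has $Q$ tends to $1$ as $n\to\infty$. *)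

(* Defs.v *)
From mathcomp Require Import all_boot all_order all_fingroup all_algebra.
Set Implicit Arguments. Unset Strict Implicit. Unset Printing Implicit Defensive.
Import GRing.Theory Num.Theory.

Definition is_graph (n : nat) (E : {set {set 'I_n}}) : bool :=
  [forall e in E, #|e| == 2].

Definition Graphs (n : nat) : {set {set {set 'I_n}}} :=
  [set E | is_graph E].

Definition adj (n : nat) (E : {set {set 'I_n}}) (i j : 'I_n) : bool :=
  [set i; j] \in E.

Definition isomorphic (n : nat) (E E' : {set {set 'I_n}}) : bool :=
  [exists p : {perm 'I_n}, [forall i, forall j, adj E i j == adj E' (p i) (p j)]].

Definition induced_iso (n m : nat) (G : {set {set 'I_n}}) (S : {set 'I_n})
    (F : {set {set 'I_m}}) : bool :=
  [exists f : {ffun 'I_m -> 'I_n},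
    [&& injectiveb f, f @: setT == S &
        [forall a, forall b, adj G (f a) (f b) == adj F a b]]].

Definition mult (n m : nat) (G : {set {set 'I_n}}) (F : {set {set 'I_m}}) : nat :=
  #|[set S : {set 'I_n} | (#|S| == m) && induced_iso G S F]|.

(* ceil(3 log_2 n) = least k with n^3 <= 2^k (for n >= 1). *)
Definition deck_size (n : nat) : nat := up_log 2 (n ^ 3).

Definition deck_determines (n : nat) (G : {set {set 'I_n}}) : bool :=
  [forall G' in Graphs n,
     [forall F in Graphs (deck_size n), mult G F == mult G' F]
       ==> isomorphic G G'].

Definition prob (n : nat) (Q : {set {set 'I_n}} -> bool) : rat :=
  (#|[set G in Graphs n | Q G]|%:R / #|Graphs n|%:R)%R.

(* Main.v *)
Require Import Defs.
From mathcomp Require Import all_boot all_order all_fingroup all_algebra.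
From mathcomp Require Import zify ring lra.
Set Implicit Arguments.
Unset Strict Implicit.
Unset Printing Implicit Defensive.
Import Order.TTheory GRing.Theory Num.Theory.

(** Fix a set U of k - 2 vertices, k = ceil(3 log_2 n). With high probability
    (a) the identity is the only embedding of G[U] into G, and (b) distinct
    vertices outside U have distinct neighbourhoods in U. Then G is determined
    merely by which k-vertex graphs occur in it: if G' has the same ones, it
    contains a copy U' of G[U], and for x', y' outside U' the graph
    G'[U' + x' + y'] occurs in G, where by (a) it must be G[U + x + y] for some
    x, y, with U' matched to U in the prescribed way. By (b), x depends on x'
    only, and x' |-> x is an isomorphism outside U'.

    For (a), let f embed U in V, moving j points and sending t of them outside
    U. Among the constraints e ~ f(e) on pairs e of U, one finds t(m-1)/2
    independent ones (pairs mapped outside U) and j(m-2)/6 independent ones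
    (a third of the moved pairs), where m = k - 2. A suitable convex
    combination of both bounds, with l = ceil(k/3) >= log_2 n, shows that
    f is an embedding with probability at most 2^-(p j + l t) for p about l/8.
    This weight is a product over the points of U, so its sum over all f is
    at most (1 + (m+1) 2^-p)^m, which tends to 1, the weight of the identity. *)

(** * Reconstruction of a rigid, separated graph from its deck *)

Section Deterministic.

Variable n : nat.
Implicit Types (G : {set {set 'I_n}}) (x y : 'I_n).

Lemma adjC G x y : adj G x y = adj G y x.
Proof. by rewrite /adj setUC. Qed.

Lemma adj_irrefl G x : is_graph G -> adj G x x = false.
Proof.
move=> /forall_inP gG; apply/negP => /gG.
by rewrite setUid cards1.
Qed.

(** The set U is represented by an injection [i]; for [f] injective, [i a |-> f a] is then an
    embedding of G[U] into G. *)
Definition copies m (i f : 'I_m -> 'I_n) G :=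
  [forall a, forall b, adj G (f a) (f b) == adj G (i a) (i b)].

Definition twins m (i : 'I_m -> 'I_n) G x y :=
  [forall a, adj G x (i a) == adj G y (i a)].

(** The graph that [f] pulls back from [G] has positive multiplicity in [G], hence in [G']; any map
    witnessing this serves as [f']. *)
Lemma deck_transfer k G G' (f : 'I_k -> 'I_n) :
    is_graph G -> injective f ->
    {in Graphs k, forall F, mult G F = mult G' F} ->
  exists2 f' : 'I_k -> 'I_n, injective f' &
    forall a b, adj G (f a) (f b) = adj G' (f' a) (f' b).
Proof.
move=> gG injf eq_deck.
pose F := [set e : {set 'I_k} | (#|e| == 2) && (f @: e \in G)].
have adjF a b : adj F a b = adj G (f a) (f b).
  rewrite /adj inE imsetU !imset_set1 cards2.
  have [->|//] := eqVneq a b.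
  by have := adj_irrefl (f b) gG; rewrite /adj => ->.
have gF : F \in Graphs k.
  by rewrite inE; apply/forall_inP => e; rewrite inE => /andP[].
have : 0 < mult G F.
  rewrite card_gt0; apply/set0Pn; exists (f @: setT).
  rewrite inE card_imset // cardsT card_ord eqxx /=.
  apply/existsP; exists (finfun f); apply/and3P; split.
  - by apply/injectiveP => a b; rewrite !ffunE => /injf.
  - by apply/eqP/eq_imset => a; rewrite ffunE.
  - by apply/forallP => a; apply/forallP => b; rewrite !ffunE adjF.
rewrite eq_deck // card_gt0 => /set0Pn[S]; rewrite inE => /andP[_].
case/existsP=> f' /and3P[/injectiveP injf' _ /forallP adjf'].
exists f' => // a b; rewrite -adjF.
by have /forallP/(_ b)/eqP := adjf' a.
Qed.

Lemma extend_two m (i : 'I_m -> 'I_n) x y :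
    injective i -> x \notin codom i -> y \notin codom i -> x != y ->
  exists2 g : 'I_m.+2 -> 'I_n, injective g &
    [/\ forall a, g (widen_ord (leqW (leqnSn m)) a) = i a,
        g (inord m) = x & g ord_max = y].
Proof.
move=> inji xNi yNi xy.
pose s := codom i ++ [:: x; y].
have sz_codom : size (codom i) = m by rewrite size_codom card_ord.
have sz_s : size s = m.+2 by rewrite size_cat sz_codom addn2.
have uniq_s : uniq s.
  have uniq_i : uniq (codom i) by apply/injectiveP.
  by rewrite cat_uniq uniq_i /= !inE xy (negbTE xNi) (negbTE yNi).
exists (fun c => nth x s c) => [a b /eqP|].
  by rewrite nth_uniq ?sz_s // => /eqP/val_inj.
split=> [a||].
- rewrite /= nth_cat sz_codom ltn_ord codomE.
  by rewrite (nth_map a) ?size_enum_ord // nth_ord_enum.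
- by rewrite inordK // nth_cat sz_codom ltnn subnn.
- by rewrite /= nth_cat sz_codom ltnNge leqnSn subSnn.
Qed.

Lemma two_outside_codom m (i : 'I_m -> 'I_n) :
    m.+2 <= n ->
  exists x y, [/\ x \notin codom i, y \notin codom i & x != y].
Proof.
move=> le_m2n.
pose A := [set x in codom i].
have /card_gt1P[x [y []]] : 1 < #|~: A|.
  have leA : #|A| <= m.
    by rewrite cardsE (leq_trans (card_size _)) // size_codom card_ord.
  have := cardsC A; rewrite card_ord; lia.
by rewrite !inE => xNi yNi xy; exists x, y; split.
Qed.

Lemma deck_reconstruct m (i : 'I_m -> 'I_n) G G' :
    m.+2 <= n -> injective i -> is_graph G -> is_graph G' ->
    (forall f, injective f -> copies i f G -> f =1 i) ->
    (forall x y, x \notin codom i -> y \notin codom i -> twins i G x y -> x = y) ->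
    {in Graphs m.+2, forall F, mult G F = mult G' F} ->
  isomorphic G G'.
Proof.
move=> le_m2n inji gG gG' rigid sep eq_deck.
pose w : 'I_m -> 'I_m.+2 := widen_ord (leqW (leqnSn m)).
(* The deck only shows graphs on [m.+2] vertices, so U is padded with two arbitrary outside
   vertices, transferred to [G'], and the padding is dropped. *)
have [phi inj_phi adj_phi] : exists2 phi : 'I_m -> 'I_n, injective phi &
    forall a b, adj G' (phi a) (phi b) = adj G (i a) (i b).
  have [x [y [xNi yNi xy]]] := two_outside_codom i le_m2n.
  have [g injg [gi _ _]] := extend_two inji xNi yNi xy.
  have [g' injg' adjg'] := deck_transfer gG injg eq_deck.
  exists (fun a => g' (w a)) => [a b /injg' /(congr1 val) /= /val_inj //|a b].
  by rewrite -adjg' !gi.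
have ext x' y' : x' \notin codom phi -> y' \notin codom phi -> x' != y' ->
  exists x y, [/\ x != y, x \notin codom i /\ y \notin codom i,
    forall a, adj G x (i a) = adj G' x' (phi a),
    forall a, adj G y (i a) = adj G' y' (phi a) &
    adj G x y = adj G' x' y'].
  move=> x'N y'N xy'.
  have [g' injg' [g'phi g'x g'y]] := extend_two inj_phi x'N y'N xy'.
  have eq_deck' : {in Graphs m.+2, forall F, mult G' F = mult G F}.
    by move=> F /eq_deck.
  have [g injg adjg] := deck_transfer gG' injg' eq_deck'.
  (* Rigidity forces the transferred copy of U' back onto U pointwise, so the two remaining vertices
     land outside U. *)
  have gi : (fun a => g (w a)) =1 i.
    apply: rigid => [a b /injg /(congr1 val) /= /val_inj //|].
    by apply/forallP => a; apply/forallP => b; rewrite -adjg !g'phi adj_phi.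
  exists (g (inord m)), (g ord_max); split.
  - by apply: contra_neq xy' => /injg; rewrite -g'x -g'y => ->.
  - split; apply/codomP => -[a]; rewrite -gi => /injg/(congr1 val) /= E;
      move: (ltn_ord a); rewrite -E ?inordK; lia.
  - by move=> a; rewrite -(gi a) -adjg g'x g'phi.
  - by move=> a; rewrite -(gi a) -adjg g'y g'phi.
  - by rewrite -adjg g'x g'y.
(* The image of [z'] is prescribed on U'; outside, it is any vertex with the corresponding
   neighbourhood in U. *)
pose R z' z := (exists2 a, z' = phi a & z = i a) \/
  [/\ z' \notin codom phi, z \notin codom i &
      forall a, adj G z (i a) = adj G' z' (phi a)].
have [psi psiP] : exists psi, forall z', R z' (psi z').
  apply: fin_all_exists => z'.
  have [/codomP[a ->]|z'N] := boolP (z' \in codom phi).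
    by exists (i a); left; exists a.
  have [x' [y' [x'N y'N xy']]] := two_outside_codom phi le_m2n.
  (* [ext] works on pairs; any second vertex outside U' will do here. *)
  have [u uN zu] : exists2 u, u \notin codom phi & z' != u.
    by have [zx|] := eqVneq z' x'; [exists y' => //; rewrite zx | exists x'].
  have [x [y [_ [xN _] adjx _ _]]] := ext _ _ z'N uN zu.
  by exists x; right.
have psi_ext x' y' : x' != y' -> psi x' != psi y' /\
    adj G (psi x') (psi y') = adj G' x' y'.
  move=> xy'.
  have [[a ax ->]|[x'N xN adjx]] := psiP x'; have [[b bx ->]|[y'N yN adjy]] := psiP y'.
  - split; last by rewrite ax bx adj_phi.
    by apply: contra_neq xy' => /inji ab; rewrite ax bx ab.
  - split; last by rewrite adjC adjy ax adjC.
    by apply: contraNneq yN => <-; apply: codom_f.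
  - split; last by rewrite adjx bx.
    by apply: contraNneq xN => ->; apply: codom_f.
  (* The pair supplied by [ext] has the same neighbourhoods in U as [psi x'] and [psi y'], so
     separation identifies them. *)
  - have [x [y [xy [xN1 yN1] adjx1 adjy1 <-]]] := ext _ _ x'N y'N xy'.
    have -> : psi x' = x.
      by apply: sep => //; apply/forallP => a; rewrite adjx adjx1.
    suff -> : psi y' = y by [].
    by apply: sep => //; apply/forallP => a; rewrite adjy adjy1.
have inj_psi : injective psi.
  move=> x' y' eq_psi; apply/eqP; apply: contraT => /psi_ext[].
  by rewrite eq_psi eqxx.
(* [psi] maps [G'] to [G], whence the inverse. *)
apply/existsP; exists (perm inj_psi)^-1%g.
apply/forallP => x; apply/forallP => y; apply/eqP.
have [<-|xy] := eqVneq x y; first by rewrite !adj_irrefl.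
have /psi_ext[_ <-] : (perm inj_psi)^-1%g x != (perm inj_psi)^-1%g y.
  by rewrite (inj_eq perm_inj).
by rewrite -!(permE inj_psi) !permKV.
Qed.

End Deterministic.

(** * Independent constraints and double counting *)

(** Since each [u e] avoids [v @: P], the set [E] is recovered from [E :\: v @: P], so every
    constraint halves the count. *)
Lemma card_constrained (T I : finType) (X : {set T}) (P : {set I}) (u v : I -> T) :
    {in P &, injective v} -> v @: P \subset X -> [disjoint u @: P & v @: P] ->
  #|[set E in powerset X | [forall e in P, (v e \in E) == (u e \in E)]]| * 2 ^ #|P|
    <= 2 ^ #|X|.
Proof.
move=> injv vX uv0; set S := [set E in _ | _].
have card_vP : #|v @: P| = #|P| by apply: card_in_imset.
have le_PX : #|P| <= #|X| by rewrite -card_vP subset_leq_card.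
rewrite -(subnK le_PX) expnD leq_mul2r expn_eq0 /=.
have <- : #|X :\: v @: P| = #|X| - #|P|.
  by rewrite cardsD (setIidPr vX) card_vP.
rewrite -card_powerset -(@card_in_imset _ _ (fun E => E :\: v @: P) S).
  apply/subset_leq_card/subsetP => _ /imsetP[E ES ->].
  move: ES; rewrite inE !powersetE => /andP[EX _].
  exact: setSD.
move=> E E'; rewrite !inE => /andP[_ /forall_inP vE] /andP[_ /forall_inP vE'].
move=> /setP eqD; apply/setP => e.
have := eqD e; rewrite !inE.
have [/imsetP[a aP ->] _|//] := boolP (e \in v @: P).
rewrite (eqP (vE a aP)) (eqP (vE' a aP)).
have := eqD (u a); rewrite !inE.
have ua : u a \in u @: P by apply: imset_f.
by rewrite (disjointFr uv0 ua).
Qed.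

(** Each member of a maximal independent family excludes at most one further element through [u] and
    one through [v], hence the factor 3. *)
Lemma large_independent (T I : finType) (N : {set I}) (u v : I -> T) :
    injective u -> injective v -> {in N, forall e, u e != v e} ->
  exists P : {set I}, [/\ P \subset N, [disjoint u @: P & v @: P] & #|N| <= 3 * #|P|].
Proof.
move=> inju injv uv.
pose indep (P : {set I}) := (P \subset N) && [disjoint u @: P & v @: P].
have [|P /maxsetP[/andP[sPN uv0] maxP]] := @ex_maxset _ indep.
  by exists set0; rewrite /indep sub0set -setI_eq0 imset0 set0I eqxx.
exists P; split=> //.
(* By maximality, any other element of [N] is mapped by [u] or [v] to the other image of [P]. *)
have sN : N \subset P :|: (u @^-1: (v @: P) :|: v @^-1: (u @: P)).
  apply/subsetP => e eN; rewrite !inE -implyNb -implyNb.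
  apply/implyP => eP; apply/implyP => uP; apply: contraT => vP.
  have /maxP eq_P : indep (e |: P).
    rewrite /indep subUset sub1set eN sPN !imsetU1 /=.
    rewrite -setI_eq0; apply/eqP/setP => z; rewrite !inE.
    apply/negbTE/negP => /andP[/predU1P[->|zu] /predU1P[E|zv]].
    - by have := uv e eN; rewrite E eqxx.
    - by rewrite zv in uP.
    - by rewrite -E zu in vP.
    - by rewrite (disjointFr uv0 zu) in zv.
  by rewrite -eq_P ?setU11 ?subsetUr in eP.
have cp (w1 w2 : I -> T) : injective w1 -> #|w1 @^-1: (w2 @: P)| <= #|P|.
  move=> inj1; rewrite -(card_imset _ inj1).
  apply: leq_trans (leq_imset_card w2 P).
  by apply/subset_leq_card/subsetP => z /imsetP[e]; rewrite inE => e_v ->.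
apply: leq_trans (subset_leq_card sN) _; apply: leq_trans (leq_card_setU _ _) _.
rewrite mulSn leq_add2l; apply: leq_trans (leq_card_setU _ _) _.
by rewrite mulSn mul1n leq_add ?cp.
Qed.

(** Double counting of incidences: each pair in [N] has only two ends. *)
Lemma leq_card_pairs (I : finType) (N : {set {set I}}) (D : {set I}) (d : nat) :
    {in N, forall e : {set I}, #|e| = 2} ->
    {in D, forall a, exists2 B : {set I}, d <= #|B| &
      {in B, forall b, (b != a) && ([set a; b] \in N)}} ->
  d * #|D| <= 2 * #|N|.
Proof.
move=> N2 degD.
have -> : 2 * #|N| = \sum_(e in N) \sum_(a in e) 1.
  by rewrite mulnC -sum_nat_const; apply: eq_bigr => e /N2 <-; rewrite sum1_card.
rewrite mulnC -sum_nat_const (exchange_big_dep predT) //=.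
rewrite [leqRHS](bigID (mem D)) /= -[leqLHS]addn0 leq_add //.
apply: leq_sum => a /degD[B leB BN]; apply: leq_trans leB _.
rewrite sum1dep_card.
have injB : {in B &, injective (fun b => [set a; b])}.
  move=> b c /BN/andP[ba _] _ /setP/(_ b).
  by rewrite !inE eqxx orbT (negbTE ba) /= => /esym/eqP.
rewrite -(card_in_imset injB).
apply/subset_leq_card/subsetP => _ /imsetP[b /BN/andP[_ bN] ->].
by rewrite !inE bN eqxx.
Qed.

Definition pairs (T : finType) : {set {set T}} := [set e : {set T} | #|e| == 2].

Lemma Graphs_powerset n : Graphs n = powerset (pairs 'I_n).
Proof.
apply/setP => E; rewrite !inE; apply/forall_inP/subsetP => sE e /sE; by rewrite inE.
Qed.

(** * Number of graphs with a given embedding of U or a given pair of twins *)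

Section Counting.

Variables (n m : nat) (i : 'I_m -> 'I_n).
Hypothesis inji : injective i.

Definition moved (f : 'I_m -> 'I_n) := [set a | f a != i a].
Definition escaping (f : 'I_m -> 'I_n) := [set a | f a \notin codom i].

Lemma card_copies_indep (f : 'I_m -> 'I_n) (P : {set {set 'I_m}}) :
    injective f -> P \subset pairs 'I_m ->
    [disjoint [set i @: e | e : {set 'I_m} in P] & [set f @: e | e : {set 'I_m} in P]] ->
  #|[set G in Graphs n | copies i f G]| * 2 ^ #|P| <= 2 ^ #|pairs 'I_n|.
Proof.
move=> injf /subsetP P2 disjP.
have subX : [set f @: e | e : {set 'I_m} in P] \subset pairs 'I_n.
  apply/subsetP => _ /imsetP[e /P2 e2 ->]; move: e2.
  by rewrite !inE card_imset.
apply: leq_trans (card_constrained (in2W (imset_inj injf)) subX disjP).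
rewrite leq_mul2r; apply/orP; right.
apply/subset_leq_card/subsetP => G; rewrite inE Graphs_powerset => /andP[GX /forallP cG].
rewrite inE GX; apply/forall_inP => e /P2; rewrite inE => /cards2P[a [b [_ ->]]].
by rewrite !imsetU !imset_set1; have /forallP := cG a; apply.
Qed.

(** Take all pairs with an escaping end: their images under [f] leave U, while those under [i] stay
    inside. *)
Lemma escaping_indep (f : 'I_m -> 'I_n) :
  exists P : {set {set 'I_m}}, [/\ P \subset pairs 'I_m,
    [disjoint [set i @: e | e : {set 'I_m} in P] & [set f @: e | e : {set 'I_m} in P]] &
    (m.-1 * #|escaping f| <= 2 * #|P|)%N].
Proof.
pose P : {set {set 'I_m}} := [set e in pairs 'I_m | [exists a in e, a \in escaping f]].
exists P; split; first by apply/subsetP => e; rewrite inE => /andP[].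
- rewrite -setI_eq0; apply/eqP/setP => z; rewrite !inE.
  apply/negbTE/negP => /andP[/imsetP[e _ ->] /imsetP[e' + E]].
  rewrite inE => /andP[_ /exists_inP[a ae']]; rewrite inE => /negP; apply.
  have : f a \in i @: e by rewrite E imset_f.
  by case/imsetP=> b _ ->; apply: codom_f.
- apply: leq_card_pairs => [e|a aE].
    by rewrite inE => /andP[+ _]; rewrite inE => /eqP.
  exists [set~ a]; first by rewrite cardsC1 card_ord.
  move=> b; rewrite !inE => ba; apply/and3P; split=> //.
    by rewrite cards2; case: (eqVneq a b) => // ab; rewrite ab eqxx in ba.
  by apply/exists_inP; exists a; rewrite // !inE eqxx.
Qed.

Lemma moved_indep (f : 'I_m -> 'I_n) : injective f ->
  exists P : {set {set 'I_m}}, [/\ P \subset pairs 'I_m,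
    [disjoint [set i @: e | e : {set 'I_m} in P] & [set f @: e | e : {set 'I_m} in P]] &
    (m.-2 * #|moved f| <= 6 * #|P|)%N].
Proof.
move=> injf.
pose N : {set {set 'I_m}} := [set e in pairs 'I_m | i @: e != f @: e].
have [|P [sPN disjP leN]] := large_independent (N := N) (imset_inj inji) (imset_inj injf).
  by move=> e; rewrite inE => /andP[].
exists P; split=> //.
  by apply: subset_trans sPN _; apply/subsetP => e; rewrite inE => /andP[].
apply: leq_trans (_ : 2 * #|N| <= _); last by move: leN; lia.
apply: leq_card_pairs => [e|a]; first by rewrite inE => /andP[+ _]; rewrite inE => /eqP.
rewrite inE => fia.
(* A pair containing the moved point [a] has equal images only if [f a = i b], which rules out at
   most one partner [b]. *)
exists ([set~ a] :\: [set b | i b == f a]).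
  rewrite cardsD cardsC1 card_ord -subn1 leq_sub2l //.
  apply: leq_trans (subset_leq_card (subsetIr _ _)) _.
  apply/card_le1_eqP => b c; rewrite !inE => /eqP <- /eqP.
  by move/inji.
move=> b; rewrite !inE => /andP[ib ba]; apply/and3P; split=> //.
    by rewrite cards2; case: (eqVneq a b) => // ab; rewrite ab eqxx in ba.
apply: contraNneq ib => /setP/(_ (f a)).
rewrite !imsetU !imset_set1 !inE eqxx (negbTE fia) /= => /eqP ->.
by [].
Qed.

Lemma card_copies (f : 'I_m -> 'I_n) p l :
    injective f -> 15 <= l -> 8 * p + 2 <= l -> 3 * l - 4 <= m ->
  #|[set G in Graphs n | copies i f G]| * 2 ^ (p * #|moved f| + l * #|escaping f|)
    <= 2 ^ #|pairs 'I_n|.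
Proof.
move=> injf l15 lel lem.
have [P1 [sP1 disjP1 leP1]] := escaping_indep f.
have [P2 [sP2 disjP2 leP2]] := moved_indep injf.
(* If both [|P1|, |P2| < S] then [6 |P1| + 2 |P2| < 8 S], against the two lower bounds. *)
set S := _ + _.
have [leS|gtS1] := leqP S #|P1|.
  apply: leq_trans (card_copies_indep injf sP1 disjP1).
  by rewrite leq_mul2l leq_exp2l ?leS ?orbT.
have [leS|gtS2] := leqP S #|P2|.
  apply: leq_trans (card_copies_indep injf sP2 disjP2).
  by rewrite leq_mul2l leq_exp2l ?leS ?orbT.
(* From [m.-2 >= 3 * l - 6 >= 24 * p] one gets [2 |P2| >= 8 p j], and from
   [3 * (3 * l - 5) >= 8 * l], valid once [l >= 15], one gets [6 |P1| >= 8 l t]. *)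
have h1 : (3 * l - 5) * #|escaping f| <= 2 * #|P1|.
  by apply: leq_trans leP1; rewrite leq_mul2r; apply/orP; right; lia.
have h2 : (24 * p) * #|moved f| <= 6 * #|P2|.
  by apply: leq_trans leP2; rewrite leq_mul2r; apply/orP; right; lia.
have h3 : 8 * (l * #|escaping f|) <= 3 * ((3 * l - 5) * #|escaping f|).
  by rewrite !mulnA leq_mul2r; apply/orP; right; lia.
move: gtS1 gtS2 h1 h2 h3; rewrite /S -!mulnA.
move: (p * _) ((3 * l - 5) * _) (l * #|escaping f|) #|P1| #|P2| => *; lia.
Qed.

(** The [m] pairs joining [x] to U are distinct, and disjoint from those joining [y] to U, so the
    constraints are independent. *)
Lemma card_twins x y : x \notin codom i -> y \notin codom i -> x != y ->
  #|[set G in Graphs n | twins i G x y]| * 2 ^ m <= 2 ^ #|pairs 'I_n|.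
Proof.
move=> xN yN xy; pose u z (a : 'I_m) := [set z; i a].
have inju z : z \notin codom i -> injective (u z).
  move=> zN a b /setP/(_ (i a)); rewrite !inE eqxx orbT.
  case/esym/predU1P => [E|/eqP/inji //].
  by rewrite -E codom_f in zN.
have subX : u x @: setT \subset pairs 'I_n.
  apply/subsetP => _ /imsetP[a _ ->]; rewrite inE cards2.
  by have -> : x != i a by apply: contraNneq xN => ->; apply: codom_f.
have disj : [disjoint u y @: setT & u x @: setT].
  rewrite -setI_eq0; apply/eqP/setP => z; rewrite !inE.
  apply/negbTE/negP => /andP[/imsetP[a _ ->] /imsetP[b _]] /setP/(_ x).
  rewrite !inE eqxx (negbTE xy) /=.
  by move/eqP => E; rewrite E codom_f in xN.
have := card_constrained (in2W (inju x xN)) subX disj.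
rewrite cardsT card_ord; apply: leq_trans.
rewrite leq_mul2r; apply/orP; right.
apply/subset_leq_card/subsetP => G; rewrite inE Graphs_powerset => /andP[GX /forallP tG].
by rewrite inE GX; apply/forall_inP => a _; apply: tG.
Qed.

End Counting.

(** * Union bounds over embeddings and over pairs of vertices *)

Lemma leq_card_bigcup (I T : finType) (P : pred I) (F : I -> {set T}) :
  #|\bigcup_(k | P k) F k| <= \sum_(k | P k) #|F k|.
Proof.
elim/big_rec2: _ => [|k s A _ leA]; first by rewrite cards0.
by apply: leq_trans (leq_card_setU _ _) _; rewrite leq_add2l.
Qed.

Local Open Scope ring_scope.

(** A reverse Bernoulli inequality: in the induction, the cross term [2 * m * x * x] is at most
    [x]. *)
Lemma exprD1_le (R : realFieldType) (x : R) m :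
  0 <= x -> 2 * m%:R * x <= 1 -> (1 + x) ^+ m <= 1 + 2 * m%:R * x.
Proof.
move=> x0; elim: m => [|m IHm] mx; first by rewrite expr0; lra.
have m0 : 0 <= m%:R :> R by apply: ler0n.
move: mx; rewrite -natr1 => mx.
have {}IHm := IHm ltac:(nra).
rewrite exprS; apply: le_trans (ler_wpM2l _ IHm) _; first by lra.
have : 2 * m%:R * x * x <= x by apply: ler_piMl => //; lra.
nra.
Qed.

Lemma sum_weights (n m : nat) (i : 'I_m -> 'I_n) (x z : rat) :
    0 <= x -> 0 <= z -> n%:R * z <= 1 ->
  \sum_(f : {ffun 'I_m -> 'I_n} | f != finfun i)
      x ^+ #|moved i f| * z ^+ #|escaping i f|
    <= (1 + m.+1%:R * x) ^+ m - 1.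
Proof.
move=> x0 z0 nz.
pose c (a : 'I_m) (v : 'I_n) := x ^+ (v != i a) * z ^+ (v \notin codom i).
have prodc (f : 'I_m -> 'I_n) : \prod_a c a (f a) = x ^+ #|moved i f| * z ^+ #|escaping i f|.
  have card_pred (B : pred 'I_m) : #|[set a | B a]| = (\sum_a B a)%N.
    by rewrite -sum1dep_card big_mkcond; apply: eq_bigr => a _; case: (B a).
  by rewrite big_split /= !prodrXr -!card_pred.
rewrite lerBrDr.
have c_id : x ^+ #|moved i (finfun i)| * z ^+ #|escaping i (finfun i)| = 1.
  rewrite -prodc big1 // => a _.
  by rewrite /c ffunE eqxx codom_f mulr1.
rewrite -[X in _ + X <= _]c_id addrC -(bigD1 (finfun i) (P := predT)) //=.
under eq_bigr do rewrite -prodc.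
rewrite -(bigA_distr_bigA c) -[X in _ ^+ X](card_ord m) -prodr_const.
apply: ler_prod => a _; apply/andP; split.
  by apply: sumr_ge0 => v _; rewrite mulr_ge0 ?exprn_ge0.
(* A value has weight 1 if fixed, [x] if moved within U and [x * z] if escaping; adding all three
   weights only overestimates. *)
apply: le_trans (_ : \sum_v ((v == i a)%:R + x * (v \in codom i)%:R + x * z) <= _).
  apply: ler_sum => v _; rewrite /c.
  have xz0 : 0 <= x * z by rewrite mulr_ge0.
  have [->|_] := eqVneq v (i a).
    by rewrite codom_f /= !expr0; lra.
  by case: (v \in codom i); rewrite /= ?expr0 ?expr1; lra.
rewrite !big_split /= -mulr_sumr.
have -> : \sum_(v < n) x * z = x * (n%:R * z).
  by rewrite sumr_const card_ord mulr_natl mulrnAr.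
have -> : \sum_(v : 'I_n) (v == i a)%:R = 1 :> rat.
  rewrite (bigD1 (i a)) //= eqxx big1 ?addr0 // => v /negbTE -> //.
rewrite -natr_sum.
have le_m : (\sum_(v : 'I_n) (v \in codom i) <= m)%N.
  have size_i : size (codom i) = m by rewrite size_codom card_ord.
  rewrite -[leqRHS]size_i; apply: leq_trans (card_size _).
  by rewrite -sum1_card [leqRHS]big_mkcond; apply: leq_sum => v _; case: ifP.
have : x * (\sum_(v : 'I_n) (v \in codom i))%:R <= x * m%:R.
  by rewrite ler_wpM2l // ler_nat.
have : x * (n%:R * z) <= x by rewrite ler_piMr.
rewrite -natr1; lra.
Qed.

(** With [x = 2^-p] and [z = 2^-l], the proportion of graphs that [f] embeds U into is at most its
    weight. The last two hypotheses are the smallness conditions of [sum_weights] and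
    [exprD1_le]. *)
Lemma card_not_rigid n m (i : 'I_m -> 'I_n) p l :
    injective i -> (15 <= l)%N -> (8 * p + 2 <= l)%N -> (3 * l - 4 <= m)%N ->
    (n <= 2 ^ l)%N -> (2 * m * m.+1 <= 2 ^ p)%N ->
  (#|[set G in Graphs n |
     [exists f : {ffun 'I_m -> 'I_n}, [&& injectiveb f, f != finfun i & copies i f G]]]|
    * 2 ^ p <= 2 * m * m.+1 * 2 ^ #|pairs 'I_n|)%N.
Proof.
move=> inji l15 lel lem n2l mp2.
set S := [set G in _ | _].
pose P (f : {ffun 'I_m -> 'I_n}) := injectiveb f && (f != finfun i).
pose F (f : {ffun 'I_m -> 'I_n}) := [set G in Graphs n | copies i f G].
have leS : (#|S| <= \sum_(f | P f) #|F f|)%N.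
  apply: leq_trans (leq_card_bigcup P F).
  apply/subset_leq_card/subsetP => G; rewrite inE => /andP[gG].
  case/existsP=> f /and3P[injf fi cG].
  apply/bigcupP; exists f; last by rewrite inE gG.
  by apply/andP.
pose x : rat := 2 ^- p; pose z : rat := 2 ^- l.
have x0 : 0 <= x by rewrite invr_ge0 exprn_ge0.
have z0 : 0 <= z by rewrite invr_ge0 exprn_ge0.
have x2 : x * 2 ^+ p = 1 by rewrite mulVf // expf_neq0.
have nz : n%:R * z <= 1.
  by rewrite ler_pdivrMr ?exprn_gt0 // mul1r -natrX ler_nat.
have mx : 2 * m%:R * (m.+1%:R * x) <= 1.
  rewrite mulrA ler_pdivrMr ?exprn_gt0 // mul1r.
  by rewrite -natrX -!natrM ler_nat.
set X := #|pairs _|.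
have leF (f : {ffun 'I_m -> 'I_n}) : P f ->
    #|F f|%:R <= 2 ^+ X * (x ^+ #|moved i f| * z ^+ #|escaping i f|) :> rat.
  case/andP=> /injectiveP injf _.
  have := card_copies inji injf l15 lel lem.
  rewrite -(ler_nat rat) natrM !natrX exprD !exprM -/(F f) -/X => leF.
  rewrite !exprVn -invfM ler_pdivlMr ?mulr_gt0 ?exprn_gt0 //.
have : #|S|%:R <= 2 ^+ X * (2 * m%:R * (m.+1%:R * x)) :> rat.
  apply: le_trans (_ : (\sum_(f | P f) #|F f|)%:R <= _); first by rewrite ler_nat.
  rewrite natr_sum; apply: le_trans (_ :
    \sum_(f | P f) 2 ^+ X * (x ^+ #|moved i f| * z ^+ #|escaping i f|) <= _).
    exact: ler_sum.
  rewrite -mulr_sumr ler_wpM2l ?exprn_ge0 //.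
  apply: le_trans (_ : (1 + m.+1%:R * x) ^+ m - 1 <= _).
    apply: le_trans (sum_weights i x0 z0 nz).
    (* Non-injective maps add nonnegative terms; including them is what lets the sum factor. *)
    rewrite [leRHS](bigID (fun f : {ffun _} => injectiveb f)) /=.
    rewrite (eq_bigl (fun f => (f != finfun i) && injectiveb f)); last first.
      by move=> f; rewrite andbC.
    by rewrite lerDl sumr_ge0 // => f _; rewrite mulr_ge0 ?exprn_ge0.
  by rewrite lerBlDl exprD1_le // mulr_ge0.
rewrite -(ler_nat rat) !natrM !natrX => leSx.
have c0 : 0 <= 2 ^+ p :> rat by rewrite exprn_ge0.
clear -leSx c0 x2; move: (#|S|%:R) (2 ^+ p) (2 ^+ X) x c0 x2 leSx => s c b {}x c0 xc leSx.
have -> : 2 * m%:R * m.+1%:R * b = b * (2 * m%:R * (m.+1%:R * x)) * c.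
  by rewrite -[LHS]mulr1 -xc; ring.
exact: ler_wpM2r.
Qed.


Lemma card_twinned n m (i : 'I_m -> 'I_n) : injective i ->
  (#|[set G in Graphs n | [exists x, exists y,
      [&& x \notin codom i, y \notin codom i, x != y & twins i G x y]]]| * 2 ^ m
    <= n ^ 2 * 2 ^ #|pairs 'I_n|)%N.
Proof.
move=> inji.
pose P (s : 'I_n * 'I_n) := [&& s.1 \notin codom i, s.2 \notin codom i & s.1 != s.2].
pose F (s : 'I_n * 'I_n) := [set G in Graphs n | twins i G s.1 s.2].
apply: leq_trans (_ : (\sum_(s | P s) #|F s|) * 2 ^ m <= _)%N.
  rewrite leq_mul2r; apply/orP; right; apply: leq_trans (leq_card_bigcup P F).
  apply/subset_leq_card/subsetP => G; rewrite inE => /andP[gG].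
  case/existsP=> x /existsP[y /and4P[xN yN xy tG]].
  apply/bigcupP; exists (x, y); last by rewrite inE gG.
  exact/and3P.
rewrite big_distrl /=.
apply: leq_trans (_ : \sum_(s | P s) 2 ^ #|pairs 'I_n| <= _)%N.
  by apply: leq_sum => -[x y] /and3P[*]; apply: card_twins.
rewrite sum_nat_const leq_mul2r; apply/orP; right.
by apply: leq_trans (max_card _) _; rewrite card_prod card_ord.
Qed.

Local Close Scope ring_scope.

(** * Choice of parameters and passage to the limit *)

Lemma card_Graphs n : #|Graphs n| = 2 ^ #|pairs 'I_n|.
Proof. by rewrite Graphs_powerset card_powerset. Qed.

Lemma cube_le_exp2 p : 10 <= p -> p ^ 3 <= 2 ^ p.
Proof.
elim: p => // p IHp; rewrite leq_eqVlt => /predU1P[<- //|p10].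
have {}IHp := IHp p10; rewrite [2 ^ _]expnS.
apply: leq_trans (_ : 2 * p ^ 3 <= _); last by rewrite leq_mul2l IHp orbT.
rewrite !expnS expn0 !muln1; nia.
Qed.

Lemma determined_cover n m (i : 'I_m -> 'I_n) (G : {set {set 'I_n}}) :
    deck_size n = m.+2 -> m.+2 <= n -> injective i -> G \in Graphs n ->
    ~~ [exists f : {ffun 'I_m -> 'I_n},
          [&& injectiveb f, f != finfun i & copies i f G]] ->
    ~~ [exists x, exists y,
          [&& x \notin codom i, y \notin codom i, x != y & twins i G x y]] ->
  deck_determines G.
Proof.
move=> dn le_m2n inji; rewrite inE => gG rigid sep.
rewrite /deck_determines dn; apply/forall_inP => G'; rewrite inE => gG'.
apply/implyP => /forall_inP eq_deck.
apply: (deck_reconstruct (i := i)) => // [f injf cf|x y xN yN xy|F /eq_deck/eqP //].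
  suff /eqP/ffunP eq_fi : finfun f == finfun i.
    by move=> a; have := eq_fi a; rewrite !ffunE.
  apply: contraNT rigid => f_i; apply/existsP; exists (finfun f); rewrite f_i /=.
  apply/andP; split; first by apply/injectiveP => a b; rewrite !ffunE => /injf.
  apply/forallP => a; apply/forallP => b; rewrite !ffunE.
  by have /forallP/(_ b) := forallP cf a.
apply/eqP; apply: contraNT sep => x_y.
by apply/existsP; exists x; apply/existsP; exists y; apply/and4P.
Qed.

(** With denominators cleared: [a / e <= b / c <= d / f <= d / r]. *)
Lemma cross_mul (a b c d e f r : nat) :
  a * c <= b * e -> b * f <= d * c -> r <= f -> 0 < c -> a * r <= d * e.
Proof.
move=> ac bf rf c0; rewrite -(leq_pmul2r c0).
apply: leq_trans (_ : a * c * f <= _).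
  by rewrite -!mulnA leq_mul2l [c * f]mulnC leq_mul2r rf !orbT.
apply: leq_trans (_ : b * e * f <= _); first by rewrite leq_mul2r ac orbT.
by rewrite mulnAC [leqRHS]mulnAC leq_mul2r bf orbT.
Qed.

(* The exceptional graphs make up fractions [1300 / p] for (a) and [4 / n] for (b),
   where [p, n >= r]; hence [1304 = 1300 + 4]. *)
Lemma card_determined q n : 0 < q -> 2 ^ (8 * (1304 * q) + 2) <= n ->
  #|Graphs n| * q <= #|[set G in Graphs n | deck_determines G]| * q + #|Graphs n|.
Proof.
move=> q0; move Dr: (1304 * q) => r le_n.
have r1304 : 1304 <= r by lia.
have lt_rn : 8 * r + 2 < n by apply: leq_trans le_n; apply: ltn_expl.
have n_cube : n ^ 3 <= 2 ^ n by apply: cube_le_exp2; lia.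
set k := deck_size n.
have n_k : n ^ 3 <= 2 ^ k by apply: up_logP.
have le_kn : k <= n by apply: up_log_min.
(* [l] is [k / 3] rounded up, so [n <= 2 ^ l]; [p] is the largest value with [8 * p + 2 <= l]. *)
pose l := (k + 2) %/ 3; pose p := (l - 2) %/ 8.
have n_l : n <= 2 ^ l.
  rewrite -(@leq_exp2r _ _ 3) // -expnM; apply: leq_trans n_k _.
  by rewrite leq_exp2l // /l; lia.
have r_l : 8 * r + 2 <= l by rewrite -(@leq_exp2l 2) //; apply: leq_trans n_l.
have r_p : r <= p by rewrite /p; lia.
have p_l : 8 * p + 2 <= l by rewrite /p; lia.
have [m Dm] : exists m, k = m.+2 by exists (k - 2); move: r_l; rewrite /l; lia.
have l_m : 3 * l - 4 <= m by rewrite /l; lia.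
(* Rounding gives [m <= 3 * l - 2 <= 24 * p + 25], and [p >= r] is large. *)
have m_p : m <= 25 * p by move: r_p r1304; rewrite /p /l; lia.
have p_cube : p ^ 3 <= 2 ^ p by apply: cube_le_exp2; lia.
(* Here [1300 = 2 * 25 * 26], from [m <= 25 * p] and [m.+1 <= 26 * p]. *)
have mp2 : 2 * m * m.+1 * p <= 1300 * 2 ^ p.
  apply: leq_trans (_ : 1300 * p ^ 3 <= _); last by rewrite leq_mul2l p_cube orbT.
  apply: leq_trans (_ : 2 * (25 * p) * (26 * p) * p <= _); last first.
    by rewrite !expnS expn0; lia.
  rewrite leq_mul2r; apply/orP; right; apply: leq_mul; lia.
have mp1 : 2 * m * m.+1 <= 2 ^ p.
  rewrite -(@leq_pmul2r p); last lia.
  by apply: leq_trans mp2 _; rewrite mulnC leq_mul2l; apply/orP; right; lia.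
(* The 4 is [2 ^ k / 2 ^ m]: two vertices of the deck size are spent outside U. *)
have n_m : n ^ 2 * n <= 4 * 2 ^ m.
  by rewrite -expnSr (leq_trans n_k) // Dm !expnS; lia.
have le_mn : m <= n by lia.
pose i := widen_ord le_mn; have inji : injective i by move=> a b /(congr1 val)/= /val_inj.
have l15 : 15 <= l by lia.
have := card_not_rigid inji l15 p_l l_m n_l mp1; set B1 := [set G in _ | _].
have := card_twinned inji; set B2 := [set G in _ | _].
rewrite -card_Graphs; set N := #|Graphs n| => cB2 cB1.
have cover : N <= #|[set G in Graphs n | deck_determines G]| + #|B1| + #|B2|.
  apply: leq_trans (_ : #|[set G in Graphs n | deck_determines G] :|: B1 :|: B2| <= _).
    apply/subset_leq_card/subsetP => G gG; rewrite !in_setU.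
    have [|GB1] := boolP (G \in B1); first by rewrite orbT.
    have [|GB2] := boolP (G \in B2); first by rewrite orbT.
    rewrite !orbF inE gG /=.
    rewrite /B1 inE gG in GB1; rewrite /B2 inE gG in GB2.
    by apply: (determined_cover Dm _ inji gG GB1 GB2); rewrite -Dm.
  apply: leq_trans (leq_card_setU _ _) _; rewrite leq_add2r.
  exact: leq_card_setU.
have {}cB1 : #|B1| * r <= 1300 * N.
  by apply: cross_mul cB1 mp2 r_p _; rewrite expn_gt0.
have {}cB2 : #|B2| * r <= 4 * N.
  by apply: cross_mul cB2 n_m _ _; rewrite ?expn_gt0 //; lia.
move: cover cB1 cB2; rewrite -Dr; move: #|[set G in _ | _]| #|B1| #|B2| N => d b1 b2 {}N *; nia.
Qed.

Local Open Scope ring_scope.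

(* Pr[G(n,1/2) has deck_determines] -> 1 as n -> oo. *)
Theorem theorem1 :
  forall eps : rat, 0 < eps ->
    exists N : nat, forall n : nat, (N <= n)%N ->
      1 - eps < prob (@deck_determines n).
Proof.
(* The exceptional proportion is at most [1 / q], so [q] is taken above [1 / eps]. *)
move=> eps eps0; pose q := (Num.bound eps^-1).+1.
have q_eps : 1 < q%:R * eps.
  rewrite -ltr_pdivrMr // div1r; apply: lt_le_trans (archi_boundP _) _.
    by rewrite invr_ge0 ltW.
  by rewrite ler_nat.
have q0 : (0 < q)%N by []. clearbody q.
exists (2 ^ (8 * (1304 * q) + 2))%N => n le_n.
have := card_determined q0 le_n.
have : (0 < #|Graphs n|)%N by rewrite card_Graphs expn_gt0.
rewrite /prob. move: #|Graphs n| => g; move: #|_| => d g0.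
have g0R : 0 < g%:R :> rat by rewrite ltr0n.
rewrite -(ler_nat rat) natrD !natrM ltr_pdivlMr // => gd.
have q0R : 0 < q%:R :> rat by rewrite ltr0n.
rewrite -(ltr_pM2r q0R).
have : g%:R < g%:R * (q%:R * eps) by rewrite ltr_pMr.
nra.
Qed.
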